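(* There is an algorithm which, given a permutation $\pi$ of $\{1,\dots,n\}$, outputs a maximum induced matching of the permutation graph $G(\pi)$ in $\mathcal{O}(n^2)$ time.
   Context: For a permutation $\pi=(\pi(1),\dots,\pi(n))$ of $\{1,\dots,n\}$, $\pi^{-1}(i)$ denotes the position of $i$ in $\pi$. The permutation graph $G(\pi)=(V,E)$ has $V=\{1,\dots,n\}$ and $uv\in E$ iff $(u-v)(\pi^{-1}(u)-\pi^{-1}(v))<0$. An induced matching of a graph $G=(V,E)$ is a set $M\subseteq E$ such that for any two distinct edges $u_1v_1,u_2v_2\in M$, none of $u_1u_2,u_1v_2,v_1u_2,v_1v_2$ is in $E$. A maximum induced matching is one of maximum cardinality. Running times are in the standard RAM model. *)

(* Defs.v *)
From mathcomp Require Import all_boot fingroup perm.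
Set Implicit Arguments. Unset Strict Implicit. Unset Printing Implicit Defensive.

(* Permutation graphs.  Vertices 1..n of the paper are represented by  *)
(* 'I_n (vertex i : 'I_n stands for i+1); a permutation pi is a         *)
(* {perm 'I_n} mapping positions to values, so pi^-1 u is the position  *)
(* of u.                                                               *)

(* uv in E  iff  (u - v)(pi^-1(u) - pi^-1(v)) < 0, written sign-wise. *)
Definition perm_adj (n : nat) (pi : {perm 'I_n}) (u v : 'I_n) : bool :=
  ((u < v) && ((pi^-1)%g v < (pi^-1)%g u)) ||
  ((v < u) && ((pi^-1)%g u < (pi^-1)%g v)).

Definition perm_edges (n : nat) (pi : {perm 'I_n}) : {set {set 'I_n}} :=
  [set e : {set 'I_n} | [exists u, exists v, (e == [set u; v]) && perm_adj pi u v]].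

Definition induced_matching (n : nat) (pi : {perm 'I_n}) (M : {set {set 'I_n}}) : Prop :=
  M \subset perm_edges pi /\
  forall e1 e2, e1 \in M -> e2 \in M -> e1 != e2 ->
    forall x y, x \in e1 -> y \in e2 -> ~~ perm_adj pi x y.

Definition maximum_induced_matching (n : nat) (pi : {perm 'I_n}) (M : {set {set 'I_n}}) : Prop :=
  induced_matching pi M /\
  forall M', induced_matching pi M' -> #|M'| <= #|M|.

(* A standard unit-cost RAM: countably many registers holding naturals, *)
(* instructions: constant, addition, truncated subtraction, indirect    *)
(* load/store, jump, jump-if-zero, halt.  Each executed instruction     *)
(* costs one time step.                                                 *)

Inductive instr : Type :=
| IConst of nat & nat        (* IConst r k   : M[r] := k                 *)
| IAdd of nat & nat & nat    (* IAdd r a b   : M[r] := M[a] + M[b]       *)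
| ISub of nat & nat & nat    (* ISub r a b   : M[r] := M[a] - M[b] (trunc)*)
| ILoad of nat & nat         (* ILoad r a    : M[r] := M[M[a]]           *)
| IStore of nat & nat        (* IStore a b   : M[M[a]] := M[b]           *)
| IJmp of nat                (* IJmp l       : pc := l                   *)
| IJz of nat & nat           (* IJz a l      : if M[a] = 0 then pc := l  *)
| IHalt.

Definition memory := nat -> nat.
Definition config := (nat * memory)%type.

Definition upd (m : memory) (a v : nat) : memory :=
  fun x => if x == a then v else m x.

(* One step; None means the machine has halted (IHalt or pc outside the
   program). *)
Definition step (p : seq instr) (c : config) : option config :=
  let: (pc, m) := c in
  if pc < size p then
    match nth IHalt p pc with
    | IConst r k => Some (pc.+1, upd m r k)
    | IAdd r a b => Some (pc.+1, upd m r (m a + m b))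
    | ISub r a b => Some (pc.+1, upd m r (m a - m b))
    | ILoad r a => Some (pc.+1, upd m r (m (m a)))
    | IStore a b => Some (pc.+1, upd m (m a) (m b))
    | IJmp l => Some (l, m)
    | IJz a l => Some (if m a == 0 then l else pc.+1, m)
    | IHalt => None
    end
  else None.

(* run p t c = Some m  iff the machine started in c halts after at most t
   executed instructions with final memory m. *)
Fixpoint run (p : seq instr) (t : nat) (c : config) : option memory :=
  match step p c with
  | None => Some c.2
  | Some c' => match t with 0 => None | t'.+1 => run p t' c' end
  end.

(* Input encoding: M[0] = n, M[i] = pi(i) for 1 <= i <= n (values in 1..n),
   all other registers 0. *)
Definition init_mem (n : nat) (pi : {perm 'I_n}) : memory :=
  fun a => if a == 0 then n else
    match (insub a.-1 : option 'I_n) with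
    | Some i => (pi i).+1
    | None => 0
    end.

(* Output encoding: M[0] = k, and for i < k the i-th edge is
   {M[2i+1], M[2i+2]} (vertices in 1..n). *)
Definition output_wf (n : nat) (m : memory) : Prop :=
  forall i, i < m 0 -> 0 < m (i.*2.+1) <= n /\ 0 < m (i.*2.+2) <= n.

Definition decode_output (n : nat) (m : memory) : {set {set 'I_n}} :=
  [set e : {set 'I_n} | [exists i : 'I_(m 0), exists u : 'I_n, exists v : 'I_n,
     [&& (u.+1 == m (val i).*2.+1), (v.+1 == m (val i).*2.+2) & (e == [set u; v])]]].

(* Main.v *)
Require Import Defs.
From mathcomp Require Import all_boot fingroup perm zify.

(* View the value v in position i as the point (i, v): an edge is a pair of points,
   one to the upper left of the other. Two edges are induced-independent iff all
   points of one lie to the lower left of all points of the other, so induced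
   matchings are chains of edges. Let F i v be the maximal length of a chain whose
   points have positions <= i and values <= v. A longest such chain either avoids
   position i, or avoids the value v, or its last edge joins the point in position
   i to the point of value v; hence
     F i v = max (F (i-1) v) (F i (v-1)) (F (pos v - 1) (pi i - 1) + 1),
   the last term being present when pos v < i and pi i < v. The table takes
   O(n^2) time, and a longest chain is traced back from (n, n) in O(n) steps. *)

Set Implicit Arguments. Unset Strict Implicit. Unset Printing Implicit Defensive.

(** * Running structured programs on the RAM *)

Arguments step : simpl never.

(** Counts steps exactly and may end in a running configuration, so that executions of code
    fragments compose; [run] only yields memories of halted machines. *)
Fixpoint nsteps (p : seq instr) (t : nat) (c c' : config) : Prop :=
  if t is t'.+1 then exists2 c1, step p c = Some c1 & nsteps p t' c1 c'
  else c = c'.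

Lemma nsteps_cat p t1 t2 c1 c2 c3 :
  nsteps p t1 c1 c2 -> nsteps p t2 c2 c3 -> nsteps p (t1 + t2) c1 c3.
Proof.
elim: t1 c1 => [|t1 IH] c1 /=; first by move->.
by case=> c s1 s2 s3; exists c => //; apply: IH s2 s3.
Qed.

Lemma nsteps_run p t t' c c' :
  nsteps p t c c' -> step p c' = None -> t <= t' -> run p t' c = Some c'.2.
Proof.
elim: t t' c => [|t IH] t' c /=.
  by move=> -> halt _; case: t' => [|t'] /=; rewrite halt.
case=> c1 s1 s2 halt; case: t' => // t' le_tt' /=.
by rewrite s1; apply: IH.
Qed.

(* The registers below [nreg] are addressed directly; they are kept apart from the
   rest of the memory, which is only reached through loads and stores. *)
Definition nreg := 12.
Definition state := (seq nat * memory)%type.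

Definition represents (m : memory) (st : state) : Prop :=
  (forall r, r < nreg -> m r = nth 0 st.1 r) /\
  (forall a, nreg <= a -> m a = st.2 a).

Inductive cmd : Type :=
| Block of seq instr
| Seq of cmd & cmd
| Ite of nat & cmd & cmd
| While of nat & cmd.

Fixpoint csize (c : cmd) : nat :=
  match c with
  | Block l => size l
  | Seq c1 c2 => csize c1 + csize c2
  | Ite _ c1 c2 => (csize c1 + csize c2).+2
  | While _ c => (csize c).+2
  end.

(** Jump targets are absolute, so code generation needs the address [o] of the first instruction. *)
Fixpoint compile (o : nat) (c : cmd) : seq instr :=
  match c with
  | Block l => l
  | Seq c1 c2 => compile o c1 ++ compile (o + csize c1) c2
  | Ite a c1 c2 =>
      IJz a (o + csize c1).+2 :: compile o.+1 c1 ++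
      IJmp (o + csize c1 + csize c2).+2 :: compile (o + csize c1).+2 c2
  | While a c => IJz a (o + csize c).+2 :: compile o.+1 c ++ [:: IJmp o]
  end.

Lemma size_compile o c : size (compile o c) = csize c.
Proof.
elim: c o => [l|c1 IH1 c2 IH2|a c1 IH1 c2 IH2|a c IH] o //=;
  rewrite ?size_cat /= ?IH1 ?IH2 ?IH //; lia.
Qed.

(** Total correctness with a time bound. The surrounding code [l] and [r] is arbitrary, which makes
    a specification independent of where the fragment is placed. *)
Definition terminates (c : cmd) (st : state) (t : nat) (Q : state -> Prop) :=
  forall m l r, represents m st -> exists t' m' st',
    [/\ t' <= t,
        nsteps (l ++ compile (size l) c ++ r) t' (size l, m) (size l + csize c, m'),
        represents m' st' & Q st'].

Lemma terminates_weaken c st t t' (Q Q' : state -> Prop) :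
  terminates c st t Q -> t <= t' -> (forall st', Q st' -> Q' st') ->
  terminates c st t' Q'.
Proof.
move=> ex le_tt' QQ' m l r rep.
have [t1 [m' [st' [le_t1 ns rep' /QQ' q]]]] := ex m l r rep.
by exists t1, m', st'; split=> //; apply: leq_trans le_t1 le_tt'.
Qed.

Lemma terminates_leq c st t t' Q :
  terminates c st t Q -> t <= t' -> terminates c st t' Q.
Proof. by move=> ex le_t; apply: terminates_weaken ex le_t _. Qed.

Definition instr_ok (i : instr) : bool :=
  match i with
  | IConst r _ => r < nreg
  | IAdd r a b | ISub r a b => [&& r < nreg, a < nreg & b < nreg]
  | ILoad r a | IStore r a => (r < nreg) && (a < nreg)
  | _ => false
  end.

(** Weakest precondition of straight-line code. Indirect accesses must reach [nreg] or beyond, so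
    that they never alias a directly addressed register. *)
Fixpoint wp (l : seq instr) (s : seq nat) (h : memory) (Q : state -> Prop) :=
  match l with
  | [::] => Q (s, h)
  | i :: l' =>
    match i with
    | IConst r k => wp l' (set_nth 0 s r k) h Q
    | IAdd r a b => wp l' (set_nth 0 s r (nth 0 s a + nth 0 s b)) h Q
    | ISub r a b => wp l' (set_nth 0 s r (nth 0 s a - nth 0 s b)) h Q
    | ILoad r a =>
        nreg <= nth 0 s a /\ wp l' (set_nth 0 s r (h (nth 0 s a))) h Q
    | IStore a b =>
        nreg <= nth 0 s a /\ wp l' s (upd h (nth 0 s a) (nth 0 s b)) Q
    | _ => False
    end
  end.

Lemma represents_set m s h r x : r < nreg ->
  represents m (s, h) -> represents (upd m r x) (set_nth 0 s r x, h).
Proof.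
move=> lt_r [rs rh]; split=> a /= lt_a; rewrite /upd.
  by rewrite nth_set_nth /=; case: eqP => // _; apply: rs.
by case: eqP => [eq_ar|_]; [rewrite eq_ar leqNgt lt_r in lt_a | apply: rh].
Qed.

Lemma represents_store m s h a x : nreg <= a ->
  represents m (s, h) -> represents (upd m a x) (s, upd h a x).
Proof.
move=> le_a [rs rh]; split=> b /= lt_b; rewrite /upd.
  by case: eqP => [eq_ba|_]; [rewrite eq_ba ltnNge le_a in lt_b | apply: rs].
by case: eqP => // _; apply: rh.
Qed.

Lemma step_nth l i r m :
  step (l ++ i :: r) (size l, m) =
  match i with
  | IConst r k => Some ((size l).+1, upd m r k)
  | IAdd r a b => Some ((size l).+1, upd m r (m a + m b))
  | ISub r a b => Some ((size l).+1, upd m r (m a - m b))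
  | ILoad r a => Some ((size l).+1, upd m r (m (m a)))
  | IStore a b => Some ((size l).+1, upd m (m a) (m b))
  | IJmp l => Some (l, m)
  | IJz a l' => Some (if m a == 0 then l' else (size l).+1, m)
  | IHalt => None
  end.
Proof. by rewrite /step size_cat /= -[X in X < _]addn0 ltn_add2l nth_cat ltnn subnn. Qed.

Lemma terminates_block l s h Q :
  all instr_ok l -> wp l s h Q -> terminates (Block l) (s, h) (size l) Q.
Proof.
elim: l s h => [|i l IH] s h /=.
  by move=> _ q m l r rep; exists 0, m, (s, h); split=> //=; rewrite addn0.
case/andP=> ok_i ok_l wp_i m pre r rep.
have [m1 [st1 [step_i rep1 wp1]]] : exists m1 st1,
    [/\ step (pre ++ (i :: l) ++ r) (size pre, m) = Some ((size pre).+1, m1),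
        represents m1 st1 & wp l st1.1 st1.2 Q].
  rewrite /= step_nth; case: (rep) => rs rh.
  case: i ok_i wp_i => [d k|d a b|d a b|d a|a b|//|//|//] /=.
  - move=> ok w; exists (upd m d k), (set_nth 0 s d k, h); split=> //.
    exact: represents_set.
  - case/and3P=> ok oka okb w.
    exists (upd m d (m a + m b)), (set_nth 0 s d (m a + m b), h); split=> //.
      exact: represents_set.
    by rewrite !rs.
  - case/and3P=> ok oka okb w.
    exists (upd m d (m a - m b)), (set_nth 0 s d (m a - m b), h); split=> //.
      exact: represents_set.
    by rewrite !rs.
  - case/andP=> ok oka [le w].
    exists (upd m d (m (m a))), (set_nth 0 s d (m (m a)), h); split=> //.
      exact: represents_set.
    by rewrite (rs a) //= rh.
  - case/andP=> oka okb [le w].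
    exists (upd m (m a) (m b)), (s, upd h (m a) (m b)); split=> //.
      by apply: represents_store; rewrite // (rs a).
    by rewrite /= !rs.
case: st1 rep1 wp1 => s1 h1 rep1 /= wp1.
have [t [m2 [st2 [le_t ns rep2 q]]]] := IH _ _ ok_l wp1 _ (rcons pre i) r rep1.
exists t.+1, m2, st2; split=> //=.
exists ((size pre).+1, m1) => //.
by rewrite /= size_rcons cat_rcons addSnnS in ns.
Qed.

Lemma terminates_seq c1 c2 st t1 t2 Q :
  terminates c1 st t1 (fun st' => terminates c2 st' t2 Q) ->
  terminates (Seq c1 c2) st (t1 + t2) Q.
Proof.
move=> ex1 m l r rep.
have [u1 [m1 [st1 [le1 ns1 rep1 ex2]]]] :=
  ex1 m l (compile (size l + csize c1) c2 ++ r) rep.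
have [u2 [m2 [st2 [le2 ns2 rep2 q]]]] :=
  ex2 m1 (l ++ compile (size l) c1) r rep1.
exists (u1 + u2), m2, st2; split=> //; first exact: leq_add.
rewrite size_cat size_compile -addnA -!catA in ns2.
by rewrite /= -!catA; apply: nsteps_cat ns1 ns2.
Qed.

Lemma terminates_then c1 c2 st t1 t2 (P Q : state -> Prop) :
  terminates c1 st t1 P -> (forall st', P st' -> terminates c2 st' t2 Q) ->
  terminates (Seq c1 c2) st (t1 + t2) Q.
Proof. by move=> ex1 ex2; apply: terminates_seq; apply: terminates_weaken ex1 _ _. Qed.

(** The two extra steps are the test and, after [c1], the jump over [c2]. *)
Lemma terminates_ite a c1 c2 s h t Q : a < nreg ->
  (nth 0 s a != 0 -> terminates c1 (s, h) t Q) ->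
  (nth 0 s a = 0 -> terminates c2 (s, h) t Q) ->
  terminates (Ite a c1 c2) (s, h) t.+2 Q.
Proof.
move=> lt_a ex1 ex2 m l r rep; have [rs _] := rep.
set p := l ++ _.
have [a0|a_neq0] := eqVneq (nth 0 s a) 0.
  set l1 := rcons l (IJz a (size l + csize c1).+2) ++ compile (size l).+1 c1 ++
     [:: IJmp (size l + csize c1 + csize c2).+2].
  have size_l1 : size l1 = (size l + csize c1).+2.
    by rewrite !size_cat size_rcons size_compile /=; lia.
  have [u [m1 [st1 [le1 ns1 rep1 q]]]] := ex2 a0 m l1 r rep.
  exists u.+1, m1, st1; split=> //; first lia.
  exists ((size l + csize c1).+2, m).
    by rewrite /p /= step_nth rs //= a0.
  move: ns1; rewrite size_l1 /l1 cat_rcons /= -!catA.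
  rewrite /p /= -!catA /=.
  by rewrite !addSn !addnS -addnA.
set l1 := rcons l (IJz a (size l + csize c1).+2).
have size_l1 : size l1 = (size l).+1 by rewrite size_rcons.
set r1 := IJmp (size l + csize c1 + csize c2).+2 :: compile (size l + csize c1).+2 c2 ++ r.
have [u [m1 [st1 [le1 ns1 rep1 q]]]] := ex1 a_neq0 m l1 r1 rep.
exists u.+2, m1, st1; split=> //.
exists ((size l).+1, m).
  by rewrite /p /= step_nth rs //= (negPf a_neq0).
have eq_p : p = l1 ++ compile (size l).+1 c1 ++ r1.
  by rewrite /p /l1 /r1 cat_rcons /= -!catA.
rewrite -addn1; rewrite size_l1 -eq_p in ns1.
apply: nsteps_cat ns1 _ => /=.
exists ((size l + csize c1 + csize c2).+2, m1) => //.
  rewrite eq_p catA /r1 -[(size l).+1]size_l1.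
  have -> : size l1 + csize c1 = size (l1 ++ compile (size l1) c1).
    by rewrite size_cat size_compile.
  by rewrite step_nth.
by rewrite !addnS addnA.
Qed.

(** [I k] carries a bound [k] on the remaining iterations: the body lowers it, and at [k = 0] the
    tested register must be zero. Each iteration pays for a test and the jump back; the final test
    costs one more step. *)
Lemma terminates_while (I : nat -> state -> Prop) a c k st t : a < nreg ->
  (forall k st, I k st -> nth 0 st.1 a != 0 ->
     0 < k /\ terminates c st t (I k.-1)) ->
  I k st ->
  terminates (While a c) st (k * t.+2).+1
    (fun st' => nth 0 st'.1 a = 0 /\ exists k', I k' st').
Proof.
move=> lt_a body; elim: k st => [|k IH] st Ik m l r rep; have [rs _] := rep.
  have a0 : nth 0 st.1 a = 0.
    by apply/eqP; case: eqP => // /eqP nz; have [] := body _ _ Ik nz.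
  exists 1, m, st; split=> //; last by split=> //; exists 0.
  exists ((size l + csize c).+2, m); first by rewrite /= step_nth rs //= a0.
  by rewrite /= !addnS.
have [a0|nz] := eqVneq (nth 0 st.1 a) 0.
  exists 1, m, st; split=> //; last by split=> //; exists k.+1.
  exists ((size l + csize c).+2, m); first by rewrite /= step_nth rs //= a0.
  by rewrite /= !addnS.
have [_ ex] := body _ _ Ik nz.
set p := l ++ _.
set l1 := rcons l (IJz a (size l + csize c).+2).
have size_l1 : size l1 = (size l).+1 by rewrite size_rcons.
have [u [m1 [st1 [le1 ns1 rep1 Ik1]]]] := ex m l1 (IJmp (size l) :: r) rep.
have [u2 [m2 [st2 [le2 ns2 rep2 q]]]] := IH _ Ik1 m1 l r rep1.
have eq_p : p = l1 ++ compile (size l).+1 c ++ IJmp (size l) :: r.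
  by rewrite /p /l1 cat_rcons /= -!catA.
exists (u + u2.+1).+1, m2, st2; split=> //.
  by rewrite mulSn; lia.
exists ((size l).+1, m).
  by rewrite /p /= step_nth rs //= (negPf nz).
rewrite size_l1 -eq_p in ns1.
apply: nsteps_cat ns1 _; exists (size l, m1) => //.
rewrite eq_p catA.
have -> : (size l).+1 + csize c = size (l1 ++ compile (size l).+1 c).
  by rewrite size_cat size_compile size_l1.
by rewrite step_nth.
Qed.


(** * Chains of edges *)

Section Chains.
Variable pos : nat -> nat.

(* [(w, x)] is the edge between the values [w < x], so that the position of [x]
   comes first; edges are listed from top right to bottom left. *)
Fixpoint chain (i v : nat) (l : seq (nat * nat)) : Prop :=
  if l is (w, x) :: l' then
    [/\ 0 < w < x, x <= v, 0 < pos x < pos w, pos w <= i & chain (pos x).-1 w.-1 l']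
  else True.

Definition optimum (i v k : nat) : Prop :=
  (exists2 l, chain i v l & size l = k) /\
  (forall l, chain i v l -> size l <= k).

Lemma chain_mono i v i' v' l : i <= i' -> v <= v' -> chain i v l -> chain i' v' l.
Proof.
case: l => [|[w x] l] //= le_i le_v [h1 h2 h3 h4 h5]; split=> //.
  exact: leq_trans h2 le_v.
exact: leq_trans h4 le_i.
Qed.

Lemma optimum_row0 v : optimum 0 v 0.
Proof. by split; [exists [::] | case=> [|[w x] l] //= []; lia]. Qed.

Lemma optimum_col0 i : optimum i 0 0.
Proof. by split; [exists [::] | case=> [|[w x] l] //= []; lia]. Qed.

Lemma optimum_mono i v i' v' k k' : i <= i' -> v <= v' ->
  optimum i v k -> optimum i' v' k' -> k <= k'.
Proof.
move=> le_i le_v [[l ch <-] _] [_ max]; apply: max; exact: chain_mono ch.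
Qed.

(* A chain whose first edge lies neither in positions [<= i] nor in values [<= v]
   starts with the edge between the point in position [i.+1] and the value [v.+1]:
   there is a single candidate. *)
Lemma optimum_rec i v w a b c : 0 < w -> pos w = i.+1 ->
  (forall w', 0 < w' <= v.+1 -> pos w' = i.+1 -> w' = w) -> 0 < pos v.+1 ->
  optimum i v.+1 a -> optimum i.+1 v b ->
  (pos v.+1 < i.+1 -> w < v.+1 -> optimum (pos v.+1).-1 w.-1 c) ->
  optimum i.+1 v.+1
    (if (pos v.+1 < i.+1) && (w < v.+1) then maxn (maxn a b) c.+1 else maxn a b).
Proof.
move=> w_gt0 pos_w inj_w pos_v opt_a opt_b opt_c.
have upper l : chain i.+1 v.+1 l -> size l <=
    (if (pos v.+1 < i.+1) && (w < v.+1) then maxn (maxn a b) c.+1 else maxn a b).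
  case: l => [|[w' x] l] //= [h1 h2 h3 h4 h5].
  have [le_i|gt_i] := leqP (pos w') i.
    have := opt_a.2 ((w', x) :: l); rewrite /=.
    by case: ifP => _ le; have {}le := le (And5 h1 h2 h3 le_i h5); lia.
  have [le_v|gt_v] := leqP x v.
    have := opt_b.2 ((w', x) :: l); rewrite /=.
    by case: ifP => _ le; have {}le := le (And5 h1 le_v h3 h4 h5); lia.
  have eq_x : x = v.+1 by lia.
  have eq_w : w' = w by apply: inj_w; lia.
  subst x w'; have lt_p : pos v.+1 < i.+1 by lia.
  have lt_w : w < v.+1 by lia.
  rewrite lt_p lt_w /=.
  by have := (opt_c lt_p lt_w).2 l h5; lia.
split=> //.
have [[la cha sa] _] := opt_a; have [[lb chb sb] _] := opt_b.
have base : exists2 l, chain i.+1 v.+1 l & size l = maxn a b.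
  rewrite /maxn; case: ifP => _.
    by exists lb => //; apply: chain_mono chb.
  by exists la => //; apply: chain_mono cha.
case: ifP => // /andP[lt_p lt_w].
(* If the third term does not exceed [maxn a b], [base] is the witness; otherwise the candidate edge
   is put in front of a chain for [c]. *)
rewrite {1}/maxn; case: ifP => // _.
have [[lc chc sc] _] := opt_c lt_p lt_w.
by exists ((w, v.+1) :: lc); [split; lia || done | rewrite /= sc].
Qed.

Lemma optimum_uniq i v k k' : optimum i v k -> optimum i v k' -> k = k'.
Proof.
by move=> o1 o2; apply/eqP; rewrite eqn_leq !(optimum_mono _ _ o1 o2, optimum_mono _ _ o2 o1).
Qed.

End Chains.

(** * Chains and induced matchings *)

Section Graph.
Variables (n : nat) (pi : {perm 'I_n}).

(** Truncation gives the argument [0] the position of [1], and arguments above [n] get [0]; the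
    positivity conditions in [chain] guard against both. *)
Definition position (x : nat) : nat :=
  if (insub x.-1 : option 'I_n) is Some u then ((pi^-1)%g u).+1 else 0.

Lemma position_ord (u : 'I_n) : position u.+1 = ((pi^-1)%g u).+1.
Proof. by rewrite /position /= valK. Qed.

Definition edge_of (e : nat * nat) : {set 'I_n} :=
  [set u : 'I_n | (u.+1 == e.1) || (u.+1 == e.2)].

Definition edges_of (l : seq (nat * nat)) : {set {set 'I_n}} :=
  [set e in [seq edge_of x | x <- l]].

Lemma edge_ofE (u v : 'I_n) : edge_of (u.+1, v.+1) = [set u; v].
Proof. by apply/setP => x; rewrite !inE /= !eqSS. Qed.

Lemma perm_adjN (u v : 'I_n) : u < v -> ~~ perm_adj pi u v ->
  (pi^-1)%g u < (pi^-1)%g v.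
Proof.
move=> lt_uv; rewrite /perm_adj lt_uv /= ltnNge negb_or => /andP[].
rewrite negbK leq_eqVlt => /orP[/eqP/val_inj/perm_inj eq_uv|//].
by rewrite eq_uv ltnn in lt_uv.
Qed.

Lemma perm_adjC (u v : 'I_n) : perm_adj pi u v = perm_adj pi v u.
Proof. by rewrite /perm_adj orbC. Qed.

Lemma perm_edgesP (e : {set 'I_n}) :
  reflect (exists u v : 'I_n,
    [/\ e = [set u; v], u < v & (pi^-1)%g v < (pi^-1)%g u]) (e \in perm_edges pi).
Proof.
rewrite inE; apply: (iffP existsP) => [[u /existsP[v /andP[/eqP-> ]]]|].
  case/orP=> /andP[lt1 lt2]; first by exists u, v.
  by exists v, u; rewrite setUC.
case=> u [v [-> lt1 lt2]]; exists u; apply/existsP; exists v.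
by rewrite eqxx /perm_adj lt1 lt2.
Qed.

(** The third conclusion drives the induction: every edge of the tail lies strictly to the lower
    left of both ends of the head edge, so it differs from that edge and none of its vertices is
    adjacent to an end. *)
Lemma chain_edges i v l : v <= n -> chain position i v l ->
  [/\ induced_matching pi (edges_of l), #|edges_of l| = size l &
      forall e u, e \in edges_of l -> u \in e -> u < v /\ (pi^-1)%g u < i].
Proof.
elim: l i v => [|[w x] l IH] i v le_vn /=.
  move=> _; have -> : edges_of [::] = set0 by apply/setP=> e; rewrite !inE.
  rewrite cards0; split=> //; last by move=> e u; rewrite inE.
  by split; [apply: sub0set | move=> e1 e2; rewrite inE].
case=> /andP[w_gt0 lt_wx] le_xv /andP[px_gt0 lt_pos] le_wi ch.
have [ow ew] : exists u : 'I_n, w = u.+1.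
  have lt_w : w.-1 < n by lia.
  by exists (Ordinal lt_w) => /=; lia.
have [ox ex] : exists u : 'I_n, x = u.+1.
  have lt_x : x.-1 < n by lia.
  by exists (Ordinal lt_x) => /=; lia.
subst w x; rewrite !position_ord /= !ltnS in lt_wx lt_pos le_wi ch *.
have [] := IH _ _ _ ch; first by lia.
move=> [sub ind] card region.
have edgesE : edges_of ((ow.+1, ox.+1) :: l) = [set ow; ox] |: edges_of l.
  by apply/setP=> e; rewrite !inE edge_ofE.
have adj0 e y z : e \in edges_of l -> y \in e -> z \in [set ow; ox] ->
    ~~ perm_adj pi z y.
  move=> e_l y_e; have [lt1 lt2] := region e y e_l y_e.
  by rewrite /perm_adj !inE => /orP[]/eqP->; apply/negP; lia.
have notin : [set ow; ox] \notin edges_of l.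
  apply/negP=> e_l; have [] := region _ ow e_l; first by rewrite !inE eqxx.
  by rewrite /= ltnn.
rewrite edgesE cardsU1 notin card; split=> //.
  split.
    rewrite subUset sub sub1set andbT; apply/perm_edgesP.
    by exists ow, ox.
  move=> e1 e2; rewrite !in_setU1 => /predU1P[->|e1_l] /predU1P[->|e2_l] neq y z.
  - by rewrite eqxx in neq.
  - by move=> y_e z_e; apply: adj0 e2_l z_e y_e.
  - by move=> y_e z_e; rewrite perm_adjC; apply: adj0 e1_l y_e z_e.
  - exact: ind.
move=> e u; rewrite in_setU1 => /predU1P[->|e_l].
  by rewrite !inE => /orP[]/eqP->; split=> //=; lia.
by move=> u_e; have [] := region e u e_l u_e; lia.
Qed.

(** Induction on a bound for the size: the edge with the largest vertex comes first in the chain,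
    and all other edges lie to the lower left of both its ends. *)
Lemma matching_chain M i v : induced_matching pi M ->
  (forall e u, e \in M -> u \in e -> u < v /\ (pi^-1)%g u < i) ->
  exists2 l, chain position i v l & size l = #|M|.
Proof.
move: {2}#|M| (leqnn #|M|) => k; elim: k M i v => [|k IH] M i v.
  by rewrite leqn0 => /eqP-> _ _; exists [::].
move=> le_k [sub ind] region.
have [->|[e0 e0M]] := set_0Vmem M; first by exists [::]; rewrite ?cards0.
pose top (e : {set 'I_n}) := \max_(u in e) (u : nat).
have [e eM max_e] : exists2 e, e \in M & forall f, f \in M -> top f <= top e.
  by case: (arg_maxnP top e0M) => e eM max_e; exists e.
have /perm_edgesP[w [x [eE lt_wx lt_p]]] := subsetP sub e eM.
have w_e : w \in e by rewrite eE !inE eqxx.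
have x_e : x \in e by rewrite eE !inE eqxx orbT.
have below f y : f \in M :\ e -> y \in f ->
    y < w /\ (pi^-1)%g y < (pi^-1)%g x.
  rewrite !inE => /andP[neq fM] yf.
  have /perm_edgesP[w' [x' [fE lt_wx' lt_p']]] := subsetP sub f fM.
  have nadj a b : a \in f -> b \in e -> ~~ perm_adj pi a b by apply: ind.
  have w_f : w' \in f by rewrite fE !inE eqxx.
  have x_f : x' \in f by rewrite fE !inE eqxx orbT.
  have top_e : top e = x.
    rewrite /top eE big_setU1 /= ?big_set1; first exact/maxn_idPr/ltnW.
    by rewrite inE; apply/eqP=> eq_wx; rewrite eq_wx ltnn in lt_wx.
  have le_x' : x' <= x.
    have := max_e f fM; rewrite top_e; apply: leq_trans.
    exact: (bigmax_sup x').
  (* Without adjacency, value order and position order agree between [f] and [e]. From [x' < x] the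
     position of [x'] is below that of [x], hence below that of [w], so [x' < w]; then
     [w' < x' < w < x] puts [w'] before [x]. *)
  have disj a b : a \in f -> b \in e -> (a < b) = ((pi^-1)%g a < (pi^-1)%g b).
    move=> a_f b_e; have nab := nadj a b a_f b_e.
    case: (ltngtP a b) => [lt|gt|/val_inj->]; last by rewrite ltnn.
      by rewrite (perm_adjN lt nab).
    by rewrite perm_adjC in nab; rewrite ltnNge (ltnW (perm_adjN gt nab)).
  (* A shared vertex would be adjacent to the other end of [e]. *)
  have neq_ord (a b : 'I_n) : a \in f -> b \in e -> a <> b :> nat.
    move=> a_f b_e /val_inj eq_ab; subst b.
    move: (b_e); rewrite eE !inE => /orP[]/eqP eq_a; subst a.
      by have := nadj _ _ a_f x_e; rewrite /perm_adj lt_wx lt_p.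
    by have := nadj _ _ a_f w_e; rewrite perm_adjC /perm_adj lt_wx lt_p.
  have := (disj _ _ w_f w_e, disj _ _ w_f x_e, disj _ _ x_f w_e, disj _ _ x_f x_e).
  have := (neq_ord _ _ w_f w_e, neq_ord _ _ w_f x_e).
  have := (neq_ord _ _ x_f w_e, neq_ord _ _ x_f x_e).
  move=> [n1 n2] [n3 n4] [[[d1 d2] d3] d4].
  by move: yf; rewrite fE !inE => /orP[]/eqP->;
    clear - lt_wx lt_p lt_wx' lt_p' le_x' n1 n2 n3 n4 d1 d2 d3 d4; lia.
have [] := IH (M :\ e) ((pi^-1)%g x) w _ _ below.
- by rewrite (cardsD1 e M) eM in le_k; lia.
- split; first by apply: subset_trans sub; apply: subsetDl.
  by move=> e1 e2; rewrite !inE => /andP[_ ?] /andP[_ ?]; apply: ind.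
move=> l ch_l size_l; exists ((w.+1, x.+1) :: l); last first.
  by rewrite (cardsD1 e M) eM /= size_l.
have [lt_v _] := region e x eM x_e; have [_ lt_i] := region e w eM w_e.
by rewrite /= !position_ord.
Qed.
End Graph.


(** * The program *)

(* With [L = 32 * n], the memory above [nreg] is laid out as follows, where
   [row i = L * (i + 4)]:
     [L + i.-1]        the value [pi i], for [0 < i <= n];
     [2 * L + v]       [row (pos v).-1], for [0 < v <= n];
     [3 * L + j]       the [j]-th cell of the output;
     [row i]           the value [pi i] again, for [0 < i <= n];
     [row i + v.+1]    the table entry [F i v], for [i, v <= n].
   Registers 1, 2 and 3 hold [1], [n] and [L]; during [dp] and [trace], registers
   4 and 5 hold [row i] and [v]. In [trace], registers 0 and 2 are reused for
   [3 * L] and [nreg]. *)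

(* The input occupies the registers. As [n > 0], the addresses from [32 * n] on
   are beyond both the input and the registers, and they can be computed in
   register 0 alone; [n] is recovered from [32 * n] later. *)
Definition double_n := Block (nseq 5 (IAdd 0 0 0)).

(** Register [1] is saved first, so that it can hold the increment [1] from then on. After the last
    store register [0] is [L + 10], whence the constant [10]. *)
Definition save_low := Block
  ([:: IStore 0 1; IConst 1 1] ++
   flatten [seq [:: IAdd 0 0 1; IStore 0 r] | r <- iota 2 10] ++
   [:: IConst 2 10; ISub 3 0 2; IConst 2 0; IConst 4 32; IAdd 0 2 3]).

Definition recover_n := While 0 (Block [:: ISub 0 0 4; IAdd 2 2 1]).

Definition copy_high := Seq
  (Block [:: IConst 5 11; ISub 0 2 5; IConst 4 12; IAdd 5 3 5])
  (While 0 (Block [:: ILoad 6 4; IStore 5 6; IAdd 4 4 1; IAdd 5 5 1; ISub 0 0 1])).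

(** The inverse permutation is tabulated as row addresses because the machine cannot multiply. *)
Definition init_rows := Seq
  (Block [:: IAdd 4 3 0; IAdd 6 3 3; IAdd 5 6 6; IAdd 0 2 0])
  (While 0 (Block [:: ILoad 7 4; IAdd 8 6 7; IStore 8 5; IAdd 5 5 3; IStore 5 7;
                      IAdd 4 4 1; ISub 0 0 1])).

(** With truncated subtraction, [a + (b - a)] is a maximum and a nonzero difference is a strict
    comparison; row addresses are compared in place of positions. As [F i v] has offset [v.+1],
    offset [v] reads column [v - 1] and offset [pi i] reads column [pi i - 1]. *)
Definition dp_cell := Seq
  (Block [:: IAdd 5 5 1; ISub 9 4 3;
             IAdd 10 9 5; IAdd 10 10 1; ILoad 10 10;
             IAdd 11 4 5; ILoad 11 11; ISub 11 11 10; IAdd 10 10 11;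
             IAdd 11 3 3; IAdd 11 11 5; ILoad 11 11; ISub 9 9 11])
  (Seq
    (Ite 9
      (Seq (Block [:: ISub 9 5 8])
           (Ite 9 (Block [:: IAdd 11 11 8; ILoad 11 11; IAdd 11 11 1;
                             ISub 11 11 10; IAdd 10 10 11])
                  (Block [::])))
      (Block [::]))
    (Block [:: IAdd 11 4 5; IAdd 11 11 1; IStore 11 10; ISub 7 7 1])).

Definition dp_row := Seq
  (Block [:: IAdd 4 4 3; ILoad 8 4; IConst 5 0; IAdd 7 2 5])
  (Seq (While 7 dp_cell) (Block [:: ISub 6 6 1])).

Definition dp := Seq
  (Block [:: IAdd 4 3 3; IAdd 4 4 4; IAdd 6 2 0])
  (While 6 dp_row).

(** Subtracting and adding back register [2], which holds [nreg], computes a maximum with [nreg]: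
    items destined for registers are diverted to address [nreg], and the item that belongs there
    overwrites them. *)
Definition emit := Block
  [:: ILoad 8 4;
      IAdd 7 7 1; IStore 7 8; ISub 10 7 0; ISub 10 10 2; IAdd 10 10 2; IStore 10 8;
      IAdd 7 7 1; IStore 7 5; ISub 10 7 0; ISub 10 10 2; IAdd 10 10 2; IStore 10 5;
      IAdd 6 6 1; IAdd 10 3 3; IAdd 10 10 5; ILoad 4 10; ISub 5 8 1].

Definition trace_step := Seq
  (Block [:: ISub 10 4 3; IAdd 10 10 5; IAdd 10 10 1; ILoad 10 10; ISub 10 9 10])
  (Seq
    (Ite 10
      (Seq (Block [:: IAdd 10 4 5; ILoad 10 10; ISub 10 9 10])
           (Ite 10 emit (Block [:: ISub 5 5 1])))
      (Block [:: ISub 4 4 3]))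
    (Block [:: IAdd 9 4 5; IAdd 9 9 1; ILoad 9 9])).

Definition trace := Seq
  (Block [:: IAdd 5 2 0; IAdd 0 3 3; IAdd 0 0 3; IConst 2 12; IConst 6 0;
             IConst 10 0; IAdd 7 0 10; IAdd 9 4 5; IAdd 9 9 1; ILoad 9 9])
  (While 9 trace_step).

(** Registers [0] and [1] drive the loads, as address and decrement, so they are restored last;
    meanwhile the number of edges is kept at [3 * L]. *)
Definition restore_low := Block
  ([:: IStore 0 6; IConst 2 11; IAdd 0 0 2] ++
   flatten [seq [:: ILoad r 0; ISub 0 0 1] | r <- rev (iota 2 10)] ++
   [:: ISub 0 0 1; IAdd 1 0 1; ILoad 1 1; ILoad 0 0]).

Definition main_cmd := Ite 0
  (Seq (Seq double_n save_low) (Seq recover_n (Seq copy_high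
    (Seq init_rows (Seq dp (Seq trace restore_low))))))
  (Block [::]).

Ltac run_block := apply: terminates_block; [by [] |
  lazy beta iota zeta delta [wp cat flatten foldr map rev catrev iota nseq ncons iter nth set_nth]].

Ltac heap_address := split; first by rewrite /nreg; lia.

Lemma upd_eq (m : memory) a x b : b = a -> upd m a x b = x.
Proof. by move->; rewrite /upd eqxx. Qed.

Lemma upd_neq (m : memory) a x b : b <> a -> upd m a x b = m b.
Proof. by rewrite /upd; case: eqP. Qed.

(** * Correctness of the program *)

Section Layout.

Variables (n L : nat).
Hypotheses (n_gt0 : 0 < n) (LE : L = 32 * n).

Definition row (i : nat) := L * (i + 4).

Lemma row0 : row 0 = 4 * L.
Proof. by rewrite /row mulnC. Qed.

Lemma rowS i : row i.+1 = row i + L.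
Proof. by rewrite /row addSn mulnS addnC. Qed.

Lemma row_ge i : 4 * L <= row i.
Proof. by rewrite /row mulnC leq_mul2l leq_addl orbT. Qed.

Lemma row_inj i i' a a' : a < L -> a' < L -> row i + a = row i' + a' ->
  i = i' /\ a = a'.
Proof.
move=> lt_a lt_a' /(congr1 (fun x => (x %/ L, x %% L))).
rewrite /row ![L * _]mulnC !divnMDl ?modnMDl; [|lia..].
by rewrite !divn_small // !modn_small // => -[]; lia.
Qed.

Lemma row_lt i i' : (row i' < row i) = (i' < i).
Proof. by rewrite /row ltn_pmul2l ?ltn_add2r //; lia. Qed.

Variables (value pos : nat -> nat).
Hypothesis valP : forall i, 0 < i <= n -> 0 < value i <= n /\ pos (value i) = i.
Hypothesis posP : forall x, 0 < x <= n -> 0 < pos x <= n /\ value (pos x) = x.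

Variable m0 : memory.
Hypothesis m0_0 : m0 0 = n.
Hypothesis m0_val : forall i, 0 < i <= n -> m0 i = value i.
Hypothesis m0_gt : forall a, n < a -> m0 a = 0.

(** * Moving the input and tabulating the permutation and its inverse *)

Definition saved (st : state) := exists h x5 x6 x7 x8 x9 x10 x11,
  [/\ st = ([:: L; 1; 0; L; 32; x5; x6; x7; x8; x9; x10; x11], h),
      forall i, 0 < i < nreg -> i <= n -> h (L + i.-1) = value i,
      forall i, nreg <= i <= n -> h i = value i &
      forall a, 2 * L <= a -> h a = 0].

Lemma save_low_ok :
  terminates (Seq double_n save_low) ([seq m0 r | r <- iota 0 nreg], m0) 100 saved.
Proof.
eapply terminates_leq.
  apply: terminates_seq.
  rewrite /double_n /nreg; run_block.
  rewrite m0_0.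
  have -> : n + n + (n + n) + (n + n + (n + n)) +
    (n + n + (n + n) + (n + n + (n + n))) +
    (n + n + (n + n) + (n + n + (n + n)) +
     (n + n + (n + n) + (n + n + (n + n)))) = L by lia.
  rewrite /save_low; run_block.
  do 11!heap_address.
  have -> : L + 1 + 1 + 1 + 1 + 1 + 1 + 1 + 1 + 1 + 1 - 10 = L by lia.
  do !eexists.
  - move=> i lt_i le_i; rewrite -m0_val; last lia.
    have e0 : (L + i.-1 == L) = (i.-1 == 0) by lia.
    rewrite /upd -!addnA !eqn_add2l e0 {e0 le_i}.
    by do 12!(case: i lt_i => [|i] lt_i //).
  - move=> i; rewrite /nreg => lt_i.
    by rewrite !upd_neq ?m0_val //; lia.
  - by move=> a le_a; rewrite !upd_neq ?m0_gt //; lia.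
by [].
Qed.

Definition recovered (st : state) := exists h x4 x5 x6 x7 x8 x9 x10 x11,
  [/\ st = ([:: 0; 1; n; L; x4; x5; x6; x7; x8; x9; x10; x11], h),
      forall i, 0 < i < nreg -> i <= n -> h (L + i.-1) = value i,
      forall i, nreg <= i <= n -> h i = value i &
      forall a, 2 * L <= a -> h a = 0].

Lemma recover_n_ok st : saved st ->
  terminates recover_n st (n * 4).+1 recovered.
Proof.
move=> [h [x5 [x6 [x7 [x8 [x9 [x10 [x11 [-> low high zero]]]]]]]]].
pose I k (st : state) := exists r0 r2,
  [/\ st = ([:: r0; 1; r2; L; 32; x5; x6; x7; x8; x9; x10; x11], h),
      r0 = 32 * k & r2 + k = n].
apply: (@terminates_weaken _ _ (n * 4).+1 _ _ _
  (@terminates_while I _ _ n _ 2 _ _ _)) => //.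
- move=> k _ [r0 [r2 [-> r0E r2E]]] /= nz; split; first lia.
  by run_block; exists (r0 - 32), (r2 + 1); split=> //; lia.
- by exists L, 0.
- move=> st' [/= r0 [k [r1 [r2 [E r1E r2E]]]]]; rewrite E /= in r0 *.
  have -> : r2 = n by lia.
  by rewrite r0; do 9!eexists; split.
Qed.

Definition copied (st : state) := exists h x4 x5 x6 x7 x8 x9 x10 x11,
  [/\ st = ([:: 0; 1; n; L; x4; x5; x6; x7; x8; x9; x10; x11], h),
      forall i, 0 < i <= n -> h (L + i.-1) = value i &
      forall a, 2 * L <= a -> h a = 0].

Lemma copy_high_ok st : recovered st ->
  terminates copy_high st (4 + (n * 7).+1) copied.
Proof.
move=> [h [x4 [x5 [x6 [x7 [x8 [x9 [x10 [x11 [-> low high zero]]]]]]]]]].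
apply: terminates_seq; run_block.
(* [r4] is the next input address and [k] the number of entries left; the truncated [n - 11] is zero
   for short inputs. *)
pose I k (st : state) := exists h r4 r5 r6,
  [/\ st = ([:: k; 1; n; L; r4; r5; r6; x7; x8; x9; x10; x11], h),
      k <= n - 11 /\ r4 + k = 12 + (n - 11), r5 = L + r4.-1 &
  [/\ forall i, 0 < i < r4 -> i <= n -> h (L + i.-1) = value i,
      forall i, nreg <= i <= n -> h i = value i &
      forall a, 2 * L <= a -> h a = 0]].
apply: (@terminates_weaken _ _ ((n - 11) * 7).+1 _ _ _
  (@terminates_while I _ _ (n - 11) _ 5 _ _ _)) => //.
- move=> {low high zero h} k _ [h [r4 [r5 [r6 [-> [le_k r4E] r5E [low high zero]]]]]] /= nz.
  rewrite /nreg in high.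
  split; first lia.
  run_block; do 2!heap_address.
  exists (upd h r5 (h r4)), (r4 + 1), (r5 + 1), (h r4); split; try lia.
    by do !f_equal; lia.
  split=> [i lt_i le_i|i le_i|a le_a].
  + have [eq_i|neq_i] := eqVneq i r4.
      by rewrite upd_eq ?high ?eq_i //; lia.
    by rewrite upd_neq ?low //; lia.
  + by rewrite /nreg in le_i; rewrite upd_neq ?high //; lia.
  + by rewrite upd_neq ?zero //; lia.
- by exists h, 12, (L + 11), x6; split=> //; lia.
- by lia.
- move=> st' [/= r0 [k [h' [r4 [r5 [r6 [E [le_k r4E] r5E [low' high' zero']]]]]]]].
  rewrite E /= in r0 *; rewrite r0 in r4E *.
  by do 9!eexists; split=> // i lt_i; apply: low'; lia.
Qed.

Definition tables (h : memory) :=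
  (forall v, 0 < v <= n -> h (2 * L + v) = row (pos v).-1) /\
  (forall i, 0 < i <= n -> h (row i) = value i).

Definition initialised (st : state) := exists h x4 x5 x6 x7 x8 x9 x10 x11,
  [/\ st = ([:: 0; 1; n; L; x4; x5; x6; x7; x8; x9; x10; x11], h),
      tables h &
      forall i v, v <= n -> h (row i + v.+1) = 0].

Lemma init_rows_ok st : copied st ->
  terminates init_rows st (4 + (n * 9).+1) initialised.
Proof.
move=> [h [x4 [x5 [x6 [x7 [x8 [x9 [x10 [x11 [-> low zero]]]]]]]]]].
apply: terminates_seq; run_block; rewrite (addn0 n).
pose I k (st : state) := exists h i r4 r5 r6 r7 r8,
  [/\ st = ([:: k; 1; n; L; r4; r5; r6; r7; r8; x9; x10; x11], h),
      i + k = n, [/\ r4 = L + i, r5 = row i & r6 = 2 * L] &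
  [/\ forall i, 0 < i <= n -> h (L + i.-1) = value i,
      forall j, 0 < j <= i -> h (row j) = value j /\ h (2 * L + value j) = row j.-1 &
      forall i v, v <= n -> h (row i + v.+1) = 0]].
apply: (@terminates_weaken _ _ (n * 9).+1 _ _ _
  (@terminates_while I _ _ n _ 7 _ _ _)) => //.
- move=> {low zero h} k _ [h [i [r4 [r5 [r6 [r7 [r8 [-> iE [r4E r5E r6E] [low done zero]]]]]]]]] /= nz.
  split; first lia.
  have [lo_i val_i] : 0 < h r4 <= n /\ h r4 = value i.+1.
    have -> : h r4 = value i.+1 by rewrite r4E -(low i.+1) //; lia.
    by have [] := @valP i.+1; lia.
  have ge_i := row_ge i.
  run_block; do 3!heap_address.
  exists (upd (upd h (r6 + h r4) r5) (r5 + L) (h r4)), i.+1.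
  do 5!eexists; split; first by do 2!f_equal; lia.
  + by lia.
  + by split=> //; rewrite ?rowS; lia.
  split=> [j lt_j|j lt_j|j v le_v].
  + by rewrite !upd_neq ?low //; lia.
  + have [eq_j|neq_j] := eqVneq j i.+1.
      rewrite eq_j; split; first by rewrite upd_eq // rowS r5E.
      by rewrite upd_neq ?upd_eq //; lia.
    have [d1 d2] := done j (ltac:(lia)).
    have ge_j := row_ge j.
    have [lo_j pos_j] := @valP j (ltac:(lia)).
    have [_ pos_i] := @valP i.+1 (ltac:(lia)).
    rewrite r5E -rowS; split.
      rewrite !upd_neq //; first lia.
      move=> E; have := @row_inj j i.+1 0 0; rewrite !addn0 => /(_ _ _ E) []; lia.
    rewrite !upd_neq //; first last.
      by rewrite rowS; lia.
    rewrite val_i r6E => E; have {}E : value j = value i.+1 by lia.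
    by rewrite E pos_i in pos_j; lia.
  + have ge_j := row_ge j.
    rewrite !upd_neq ?zero //; first lia.
    rewrite r5E -rowS => E.
    by have := @row_inj j i.+1 v.+1 0; rewrite addn0 => /(_ _ _ E) []; lia.
- exists h, 0, (L + 0), (L + L + (L + L)), (L + L), x7, x8; split=> //; try lia.
  + by split=> //; rewrite ?row0; lia.
  + split=> // [j|i v le_v]; first lia.
    by rewrite zero //; have := row_ge i; lia.
- move=> st' [/= r0 [k [h' [i [r4 [r5 [r6 [r7 [r8 [E iE _ [_ done' zero']]]]]]]]]]].
  rewrite E /= in r0 *; rewrite r0 in iE *.
  do 9!eexists; split=> //; split=> j lt_j.
    (* The entry of the value [j] was written when its position [pos j] was treated. *)
    by have [lo_p val_p] := posP lt_j; have [] := done' (pos j); rewrite ?val_p; lia.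
  by have [] := done' j; lia.
Qed.

(** * Filling the table *)

Definition filled (i v : nat) (h : memory) := forall i' v', i' <= n -> v' <= n ->
  (i' < i) || (i' == i) && (v' <= v) || (v' == 0) ->
  optimum pos i' v' (h (row i' + v'.+1)).

Lemma optimum_step i v a b c : i < n -> v < n ->
  optimum pos i v.+1 a -> optimum pos i.+1 v b ->
  (pos v.+1 < i.+1 -> value i.+1 < v.+1 -> optimum pos (pos v.+1).-1 (value i.+1).-1 c) ->
  optimum pos i.+1 v.+1 (if (pos v.+1 < i.+1) && (value i.+1 < v.+1)
                         then maxn (maxn a b) c.+1 else maxn a b).
Proof.
move=> lt_i lt_v; have [lo_w pos_w] := @valP i.+1 lt_i.
have [lo_p val_p] := @posP v.+1 lt_v.
apply: optimum_rec => //; [lia | | lia].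
by move=> w' lo_w' <-; have [] := @posP w'; lia.
Qed.

Lemma dp_cell_ok i v h r6 r7 x9 x10 x11 :
  i < n -> v < n -> tables h -> filled i.+1 v h ->
  terminates dp_cell
    ([:: 0; 1; n; L; row i.+1; v; r6; r7; value i.+1; x9; x10; x11], h) 30
    (fun st => exists h' y9 y10 y11,
      [/\ st = ([:: 0; 1; n; L; row i.+1; v.+1; r6; r7.-1; value i.+1; y9; y10; y11], h'),
          tables h' & filled i.+1 v.+1 h']).
Proof.
move=> lt_i lt_v tabs fill.
have [lo_w pos_w] := @valP i.+1 lt_i; have [lo_p val_p] := @posP v.+1 lt_v.
have ge_i := row_ge i; have rS := rowS i.
set w := value i.+1 in lo_w pos_w *.
set a := h (row i + v.+2); set b := h (row i.+1 + v.+1).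
set q := row (pos v.+1).-1; set c := h (q + w).
have opt_a : optimum pos i v.+1 a by apply: fill; lia.
have opt_b : optimum pos i.+1 v b by apply: fill; lia.
have opt_c : pos v.+1 < i.+1 -> w < v.+1 -> optimum pos (pos v.+1).-1 w.-1 c.
  move=> lt_p lt_w; rewrite /c; have -> : w = w.-1.+1 by lia.
  by apply: fill; lia.
have := optimum_step lt_i lt_v opt_a opt_b opt_c; set best := (if _ then _ else _).
move=> opt_best.
have ge_q := row_ge (pos v.+1).-1; rewrite -/q in ge_q.
eapply terminates_leq.
  apply: terminates_seq; run_block.
  have -> : row i.+1 - L + (v + 1) + 1 = row i + v.+2 by lia.
  have -> : row i.+1 + (v + 1) = row i.+1 + v.+1 by lia.
  have -> : L + L + (v + 1) = 2 * L + v.+1 by lia.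
  rewrite tabs.1 // -/a -/b -/q.
  have -> : row i.+1 - L - q = row i - q by lia.
  have -> : a + (b - a) = maxn a b by lia.
  rewrite addn1.
  do 3!heap_address.
  apply: (@terminates_seq _ _ _ 10 4).
  apply: (@terminates_weaken _ _ _ _ (fun st => exists y9 y11,
    st = ([:: 0; 1; n; L; row i.+1; v.+1; r6; r7; w; y9; best; y11], h))).
  - apply: (@terminates_ite _ _ _ _ _ 8) => //= cond.
    + have lt_p : pos v.+1 < i.+1.
        have : q < row i by lia.
        by rewrite row_lt; lia.
      apply: (@terminates_seq _ _ _ 1 7); run_block.
      apply: (@terminates_ite _ _ _ _ _ 5) => //= cond'.
      * run_block; heap_address.
        have -> : maxn a b + (h (q + w) + 1 - maxn a b) = best.
          by rewrite /best lt_p ifT -?/c; lia.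
        by do 2!eexists.
      * apply: (@terminates_leq _ _ 0) => //; run_block.
        have -> : maxn a b = best by rewrite /best ifF //; lia.
        by do 2!eexists.
    + apply: (@terminates_leq _ _ 0) => //; run_block.
      have ge_p : ~~ (pos v.+1 < i.+1).
        have [ip | ip] := ltnP (pos v.+1).-1 i; last by lia.
        by rewrite -row_lt -/q in ip; lia.
      have -> : maxn a b = best by rewrite /best (negPf ge_p).
      by do 2!eexists.
  - by [].
  - move=> _ [y9 [y11 ->]]; run_block; heap_address.
    have -> : row i.+1 + v.+1 + 1 = row i.+1 + v.+2 by lia.
    rewrite subn1; do 4!eexists; split; first reflexivity.
      case: tabs => tq tr; split=> j lo_j.
        by rewrite upd_neq ?tq //; lia.
      (* The head of a row has offset [0], the new entry a positive one. *)
      rewrite upd_neq ?tr // => E.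
      by have [] := @row_inj j i.+1 0 v.+2; lia.
    move=> j u le_j le_u done.
    have [/andP[/eqP-> /eqP->]|neq] := boolP ((j == i.+1) && (u == v.+1)).
      by rewrite upd_eq.
    rewrite upd_neq; first by apply: fill => //; lia.
    by move=> E; have [] := @row_inj j i.+1 u.+1 v.+2; lia.
by [].
Qed.

Lemma dp_row_ok i h r5 r6 r7 x8 x9 x10 x11 :
  i < n -> tables h -> filled i.+1 0 h ->
  terminates dp_row
    ([:: 0; 1; n; L; row i; r5; r6; r7; x8; x9; x10; x11], h) (4 + ((n * 32).+1 + 1))
    (fun st => exists h' y5 y7 y8 y9 y10 y11,
      [/\ st = ([:: 0; 1; n; L; row i.+1; y5; r6.-1; y7; y8; y9; y10; y11], h'),
          tables h' & filled i.+2 0 h']).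
Proof.
move=> lt_i tabs fill; apply: terminates_seq; run_block.
have ge_i := row_ge i.+1; rewrite -rowS tabs.2 // addn0; heap_address.
pose I k (st : state) := exists h v x9 x10 x11,
  [/\ st = ([:: 0; 1; n; L; row i.+1; v; r6; k; value i.+1; x9; x10; x11], h),
      v + k = n, tables h & filled i.+1 v h].
apply: terminates_seq.
apply: (@terminates_weaken _ _ (n * 32).+1 _ _ _
  (@terminates_while I _ _ n _ 30 _ _ _)) => //.
- move=> {tabs fill h} k _ [h [v [y9 [y10 [y11 [-> vE tabs fill]]]]]] /= nz.
  split; first lia.
  have lt_v : v < n by lia.
  eapply terminates_weaken; first exact: (dp_cell_ok lt_i lt_v tabs fill).
    by [].
  move=> _ [h' [z9 [z10 [z11 [-> tabs' fill']]]]].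
  by exists h', v.+1, z9, z10, z11; split=> //; lia.
- by exists h, 0, x9, x10, x11.
move=> st [/= r0 [k [h' [v [y9 [y10 [y11 [E vE tabs' fill']]]]]]]].
rewrite {}E /= in r0 *; have vn : v = n by lia.
subst v; run_block; rewrite subn1; do 7!eexists; split; [reflexivity|by []|].
(* Row [i.+1] is complete, and column [0] of the next row falls under the last clause of
   [filled]. *)
by move=> j u le_j le_u done; apply: fill' => //; lia.
Qed.

Definition dp_done (st : state) := exists h x5 x6 x7 x8 x9 x10 x11,
  [/\ st = ([:: 0; 1; n; L; row n; x5; x6; x7; x8; x9; x10; x11], h),
      tables h & filled n n h].

Lemma dp_ok st : initialised st ->
  terminates dp st (3 + (n * (n * 32 + 8)).+1) dp_done.
Proof.
move=> [h [x4 [x5 [x6 [x7 [x8 [x9 [x10 [x11 [-> tabs zero]]]]]]]]]].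
apply: terminates_seq; run_block.
have -> : L + L + (L + L) = row 0 by rewrite row0; lia.
rewrite addn0.
pose I k (st : state) := exists h i x5 x7 x8 x9 x10 x11,
  [/\ st = ([:: 0; 1; n; L; row i; x5; k; x7; x8; x9; x10; x11], h),
      i + k = n, tables h & filled i.+1 0 h].
apply: (@terminates_weaken _ _ _ _ _ _
  (@terminates_while I _ _ n _ (4 + ((n * 32).+1 + 1)) _ _ _)) => //.
- move=> {tabs zero h} k _ [h [i [y5 [y7 [y8 [y9 [y10 [y11 [-> iE tabs fill]]]]]]]]] /= nz.
  split; first lia.
  have lt_i : i < n by lia.
  eapply terminates_weaken;
    first exact: (dp_row_ok lt_i tabs fill).
    by [].
  move=> _ [h' [z5 [z7 [z8 [z9 [z10 [z11 [-> tabs' fill']]]]]]]].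
  by exists h', i.+1, z5, z7, z8, z9, z10, z11; split=> //; lia.
- exists h, 0, x5, x7, x8, x9, x10, x11; split=> //.
  (* Only row [0] and column [0] are claimed at the start, and the zeros of the initial memory are
     the right entries there. *)
  move=> j u le_j le_u done; rewrite zero //.
  have [->|j_gt0] := posnP j; first exact: optimum_row0.
  have -> : u = 0 by lia.
  exact: optimum_col0.
- by rewrite ltnS leq_mul2l; lia.
move=> st' [/= r0 [k [h' [i [y5 [y7 [y8 [y9 [y10 [y11 [E iE tabs' fill']]]]]]]]]]].
rewrite {}E /= in r0 *; have eq_in : i = n by lia.
subst i; do 8!eexists; split; [reflexivity|by []|].
by move=> j u le_j le_u done; apply: fill' => //; lia.
Qed.

(** * Tracing back a longest chain *)

Definition flat (out : seq (nat * nat)) := flatten [seq [:: e.1; e.2] | e <- out].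

Lemma flat_rcons out e : flat (rcons out e) = rcons (rcons (flat out) e.1) e.2.
Proof. by rewrite /flat map_rcons flatten_rcons -!cats1 -catA. Qed.

Lemma size_flat out : size (flat out) = (size out).*2.
Proof. by elim: out => //= e out ->. Qed.

Lemma nth_flat out j : j < size out ->
  nth 0 (flat out) j.*2 = (nth (0, 0) out j).1 /\
  nth 0 (flat out) j.*2.+1 = (nth (0, 0) out j).2.
Proof. by elim: out j => [|e out IH] [|j] //= /IH. Qed.

Definition complete (h : memory) := tables h /\ filled n n h.

(* The output is written twice: in full at [3 * L], and from address [nreg] on
   at its final place, where the registers are not in the way. *)
Definition written (h : memory) (items : seq nat) := forall j, j < size items ->
  h (3 * L + j.+1) = nth 0 items j /\ (nreg <= j.+1 -> h j.+1 = nth 0 items j).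

Lemma written_rcons h items x : size items < n -> written h items ->
  written (upd (upd h (3 * L + (size items).+1) x) (maxn (size items).+1 nreg) x)
          (rcons items x).
Proof.
move=> lt_s wr j; rewrite size_rcons nth_rcons /nreg => lt_j.
have [lt_js|ge_js] := ltnP j (size items).
  have [w1 w2] := wr j lt_js; rewrite /nreg in w2; rewrite !upd_neq //; lia.
have -> : j = size items by lia.
rewrite eqxx; split; last by move=> lt; rewrite upd_eq //; lia.
by rewrite upd_neq ?upd_eq //; lia.
Qed.

Lemma complete_upd h a x : (a < 2 * L) || (3 * L <= a < 4 * L) ->
  complete h -> complete (upd h a x).
Proof.
move=> lo_a [[tq tr] fill]; split; first split.
- by move=> v lo_v; rewrite upd_neq ?tq //; lia.
- by move=> i lo_i; have ge_i := row_ge i; rewrite upd_neq ?tr //; lia.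
- move=> i v le_i le_v done; have ge_i := row_ge i.
  by rewrite upd_neq; [apply: fill | lia].
Qed.

(** The measure [i + v] bounds the remaining iterations. Each emitted edge lowers [v] by at least
    two, which keeps the output within [n] cells. Any chain left in the rectangle [(i, v)] extends
    [out], and a longest one completes it to an optimum. *)
Definition trace_core k h i v out :=
  [/\ [/\ i <= n, v <= n & i + v <= k], (size out).*2 + v <= n,
      complete h, written h (flat out) &
      (forall l, chain pos i v l -> chain pos n n (out ++ l)) /\
      optimum pos n n (size out + h (row i + v.+1))].

(** The state before register [9] is reloaded with the current entry. *)
Definition trace_pre k (st : state) := exists h i v out x8 r9 x10 x11,
  st = ([:: 3 * L; 1; 12; L; row i; v; size out; 3 * L + size (flat out);
            x8; r9; x10; x11], h) /\ trace_core k h i v out.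

Definition trace_inv k (st : state) := exists h i v out x8 x10 x11,
  st = ([:: 3 * L; 1; 12; L; row i; v; size out; 3 * L + size (flat out);
            x8; h (row i + v.+1); x10; x11], h) /\ trace_core k h i v out.

Lemma emit_ok k h i v out x8 b x10 x11 :
  trace_core k h i.+1 v.+1 out -> b = h (row i.+1 + v.+2) ->
  h (row i + v.+2) < b -> h (row i.+1 + v.+1) < b ->
  terminates emit
    ([:: 3 * L; 1; 12; L; row i.+1; v.+1; size out; 3 * L + size (flat out);
         x8; b; x10; x11], h) 18 (trace_pre k.-1).
Proof.
move=> [[le_i le_v le_k] le_out comp wr [ext opt]] bE lt_a lt_b.
have [tabs fill] := comp.
have ge_i := row_ge i.+1.
have [lo_w pos_w] := @valP i.+1 le_i; have [lo_p val_p] := @posP v.+1 le_v.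
set w := value i.+1 in lo_w pos_w *.
have opt_a : optimum pos i v.+1 (h (row i + v.+2)) by apply: fill; lia.
have opt_b : optimum pos i.+1 v (h (row i.+1 + v.+1)) by apply: fill; lia.
set p := (pos v.+1).-1.
have opt_c : optimum pos p w.-1 (h (row p + w.-1.+1)) by apply: fill; lia.
have opt_ab : optimum pos i.+1 v.+1 b by rewrite bE; apply: fill; lia.
(* The program tests neither [pos v.+1 < i.+1] nor [w < v.+1]: as [b] exceeds both neighbours, only
   the third term of the recurrence can produce it. *)
have := optimum_uniq opt_ab (optimum_step le_i le_v opt_a opt_b (fun _ _ => opt_c)).
rewrite -/w; case: ifP => [/andP[lt_p lt_w]|_] b_max; last by lia.
have sz := size_flat out.
rewrite /emit; run_block.
rewrite tabs.2 // -/w.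
set s := size (flat out) in sz *.
have -> : 3 * L + s + 1 - 3 * L - 12 + 12 = maxn s.+1 nreg by rewrite /nreg; lia.
have -> : 3 * L + s + 1 + 1 - 3 * L - 12 + 12 = maxn s.+2 nreg by rewrite /nreg; lia.
have -> : 3 * L + s + 1 = 3 * L + s.+1 by lia.
have -> : 3 * L + s.+1 + 1 = 3 * L + s.+2 by lia.
have -> : L + L + v.+1 = 2 * L + v.+1 by lia.
set h1 := upd (upd h _ w) _ w.
set h2 := upd (upd h1 _ v.+1) _ v.+1.
have wr1 : written h1 (rcons (flat out) w) by apply: written_rcons => //; lia.
have wr2 : written h2 (flat (rcons out (w, v.+1))).
  rewrite flat_rcons /=.
  by have := @written_rcons h1 _ v.+1 _ wr1; rewrite size_rcons -/s; apply; lia.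
have comp2 : complete h2.
  by rewrite /h2 /h1; do 4!(apply: complete_upd; first by rewrite /nreg; lia).
have h2E a : 4 * L <= a -> h2 a = h a.
  by move=> le_a; rewrite /h2 /h1 !upd_neq // /nreg; lia.
do 6!(split; first by rewrite /nreg; lia).
rewrite comp2.1.1 // -/p.
exists h2, p, w.-1, (rcons out (w, v.+1)); do 4!eexists; split.
  rewrite size_rcons size_flat size_rcons.
  by congr ([:: _, _, _, _, _, _, _, _, _, _, _ & _], _); lia.
split=> //; rewrite ?size_rcons; [by split; lia | by lia |].
split.
  move=> l ch; rewrite cat_rcons; apply: ext => /=.
  by split=> //; rewrite -?/p ?pos_w //; lia.
rewrite h2E; last by have := row_ge p; lia.
by have -> : (size out).+1 + h (row p + w.-1.+1) = size out + h (row i.+1 + v.+2) by lia.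
Qed.

Lemma trace_step_ok k st : trace_inv k st -> nth 0 st.1 9 != 0 ->
  0 < k /\ terminates trace_step st 35 (trace_inv k.-1).
Proof.
move=> [h [i [v [out [x8 [x10 [x11 [-> core]]]]]]]] /=.
set b := h _ => b_neq0; case: (core) => [[le_i le_v le_k] le_out [tabs fill] wr [ext opt]].
have opt_b : optimum pos i v b by apply: fill; lia.
(* Border entries are [0], so a nonzero entry lies off the border. *)
have i_gt0 : 0 < i.
  case: i @b {core le_i le_k ext opt} opt_b b_neq0 => // b opt_b.
  by rewrite (optimum_uniq opt_b (optimum_row0 _ _)).
have v_gt0 : 0 < v.
  case: v @b {core le_v le_k le_out ext opt} opt_b b_neq0 => // b opt_b.
  by rewrite (optimum_uniq opt_b (optimum_col0 _ _)).
case: i i_gt0 => // i _ in b b_neq0 core le_i le_k ext opt opt_b *.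
case: v v_gt0 => // v _ in b b_neq0 core le_v le_k le_out ext opt opt_b *.
split; first lia.
have ge_i := row_ge i; have rS := rowS i.
have opt_u : optimum pos i v.+1 (h (row i + v.+2)) by apply: fill; lia.
have opt_l : optimum pos i.+1 v (h (row i.+1 + v.+1)) by apply: fill; lia.
have le_u : h (row i + v.+2) <= b by apply: optimum_mono opt_u opt_b.
have le_l : h (row i.+1 + v.+1) <= b by apply: optimum_mono opt_l opt_b.
apply: (@terminates_seq _ _ _ 5 30); run_block.
have -> : row i.+1 - L + v.+1 + 1 = row i + v.+2 by lia.
heap_address.
apply: (@terminates_seq _ _ _ 27 3).
apply: (@terminates_weaken _ _ _ _ (trace_pre k.-1)).
- apply: (@terminates_ite _ _ _ _ _ 25) => //= cond.
    apply: (@terminates_seq _ _ _ 3 22); run_block; heap_address.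
    apply: (@terminates_ite _ _ _ _ _ 20) => //= cond'.
      apply: (@terminates_leq _ _ 18) => //; apply: emit_ok core _ _ _ => //; lia.
    apply: (@terminates_leq _ _ 1) => //; run_block; rewrite subn1.
    exists h, i.+1, v, out; do 4!eexists; split; first reflexivity.
    split=> //; [by split; lia | by lia |].
    split; first by move=> l ch; apply: ext; apply: chain_mono ch.
    by have -> : h (row i.+1 + v.+1) = b by lia.
  apply: (@terminates_leq _ _ 1) => //; run_block.
  have -> : row i.+1 - L = row i by lia.
  exists h, i, v.+1, out; do 4!eexists; split; first reflexivity.
  split=> //; [by split; lia |].
  split; first by move=> l ch; apply: ext; apply: chain_mono ch.
  by have -> : h (row i + v.+2) = b by lia.
- by [].
move=> _ [h' [i' [v' [out' [y8 [r9 [y10 [y11 [-> core']]]]]]]]].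
have ge_i' := row_ge i'.
run_block; have -> : row i' + v' + 1 = row i' + v'.+1 by lia.
heap_address.
by exists h', i', v', out', y8, y10, y11.
Qed.

Definition traced (st : state) := exists h out x4 x5 x7 x8 x9 x10 x11,
  [/\ st = ([:: 3 * L; 1; 12; L; x4; x5; size out; x7; x8; x9; x10; x11], h),
      written h (flat out), (size out).*2 <= n, chain pos n n out &
      optimum pos n n (size out)].

Lemma trace_ok st : dp_done st -> terminates trace st (10 + (n.*2 * 37).+1) traced.
Proof.
move=> [h [x5 [x6 [x7 [x8 [x9 [x10 [x11 [-> tabs fill]]]]]]]]].
have ge_n := row_ge n.
apply: terminates_seq; run_block; rewrite !addn0.
have -> : row n + n + 1 = row n + n.+1 by lia.
heap_address.
have -> : L + L + L = 3 * L by lia.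
apply: (@terminates_weaken _ _ (n.*2 * 37).+1 _ _ _
  (@terminates_while trace_inv _ _ n.*2 _ 35 _ trace_step_ok _)) => //.
  exists h, n, n, [::], x8, 0, x11; split; first by rewrite addn0.
  by split=> //; [split; lia | split=> //; apply: fill; lia].
move=> st' [/= b0 [k [h' [i [v [out [y8 [y10 [y11 [E [_ le_out _ wr [ext opt]]]]]]]]]]]].
(* The loop ends at an entry [0], where [out] alone attains the optimum. *)
rewrite {}E /= in b0 *; rewrite b0 addn0 in opt *.
do 9!eexists; split; [reflexivity|by []|lia| |by []].
by rewrite -[out]cats0; apply: ext.
Qed.

(** * The output in its final place *)

Definition output_spec (m : memory) := exists out,
  [/\ m 0 = size out, chain pos n n out, optimum pos n n (size out) &
      forall j, j < size out ->
        m j.*2.+1 = (nth (0, 0) out j).1 /\ m j.*2.+2 = (nth (0, 0) out j).2].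

(** The claim is about the raw memory [m], because the output straddles registers and heap. *)
Lemma restore_low_ok st : traced st ->
  terminates restore_low st 30 (fun st' => forall m, represents m st' -> output_spec m).
Proof.
move=> [h [out [x4 [x5 [x7 [x8 [x9 [x10 [x11 [-> wr le_out ch opt]]]]]]]]]].
apply: (@terminates_leq _ _ 27) => //.
rewrite /restore_low; run_block.
do 13!heap_address.
set h1 := upd h _ _; move=> m [rs rh]; rewrite /= in rs rh.
have low r : r < nreg -> m r = h1 (3 * L + r).
  move=> lt_r; rewrite rs //.
  by do 12!(case: r lt_r => [|r] lt_r; first by congr h1; lia).
have item j : j < size (flat out) -> m j.+1 = nth 0 (flat out) j.
  move=> lt_j; have [w1 w2] := wr j lt_j; rewrite size_flat in lt_j.
  have [lt|ge] := ltnP j.+1 nreg.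
    by rewrite low // /h1 upd_neq //; lia.
  by rewrite rh // /h1 upd_neq ?w2 //; lia.
exists out; split=> //; first by rewrite low // /h1 upd_eq //; lia.
move=> j lt_j; have [<- <-] := nth_flat lt_j.
by rewrite !item // size_flat; lia.
Qed.

Lemma represents_start : represents m0 ([seq m0 r | r <- iota 0 nreg], m0).
Proof. by split=> // r lt_r; rewrite (nth_map 0) ?size_iota // nth_iota. Qed.

Lemma main_cmd_ok :
  terminates main_cmd ([seq m0 r | r <- iota 0 nreg], m0) (1000 * n ^ 2)
    (fun st => forall m, represents m st -> output_spec m).
Proof.
eapply terminates_leq.
  apply: terminates_ite => // n0; last by move: n0; rewrite /= m0_0; lia.
  eapply terminates_then; [exact: save_low_ok | move=> st /recover_n_ok ok].
  eapply terminates_then; [exact: ok | move=> {ok}{}st /copy_high_ok ok].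
  eapply terminates_then; [exact: ok | move=> {ok}{}st /init_rows_ok ok].
  eapply terminates_then; [exact: ok | move=> {ok}{}st /dp_ok ok].
  eapply terminates_then; [exact: ok | move=> {ok}{}st /trace_ok ok].
  by eapply terminates_then; [exact: ok | exact: restore_low_ok].
(* As [n > 0], the square absorbs the linear and constant costs. *)
by nia.
Qed.

End Layout.

(** * Decoding the output *)

Lemma chain_mem pos i v l w x :
  chain pos i v l -> (w, x) \in l -> 0 < w < x /\ x <= v.
Proof.
elim: l i v => [|[w' x'] l IH] i v //= [lo le_x _ _ ch].
rewrite in_cons => /predU1P[[-> ->] //|/(IH _ _ ch)]; lia.
Qed.

Lemma output_spec0 n pos m : n = 0 -> m 0 = 0 -> output_spec n pos m.
Proof.
by move=> -> m00; exists [::]; split=> //; apply: optimum_row0.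
Qed.

Section Permutation.
Variables (n : nat) (pi : {perm 'I_n}).

Lemma output_spec_wf m : output_spec n (position pi) m -> output_wf n m.
Proof.
move=> [out [m00 ch _ items]] i; rewrite m00 => lt_i; have [-> ->] := items i lt_i.
case E: (nth _ _ _) (mem_nth (0, 0) lt_i) => [w x] /(chain_mem ch) /=; lia.
Qed.

Lemma decode_outputE m out :
  m 0 = size out -> chain (position pi) n n out ->
  (forall j, j < size out ->
     m j.*2.+1 = (nth (0, 0) out j).1 /\ m j.*2.+2 = (nth (0, 0) out j).2) ->
  decode_output n m = edges_of n out.
Proof.
move=> m00 ch items; apply/setP=> e; rewrite !inE; apply/existsP/mapP.
  case=> i /existsP[u /existsP[v]].
  have lt_i : i < size out by rewrite -m00.
  have [-> ->] := items i lt_i => /and3P[/eqP eu /eqP ev /eqP->].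
  exists (nth (0, 0) out i); first exact: mem_nth.
  by rewrite -edge_ofE eu ev; case: (nth _ _ _).
case=> -[w x] wx_out ->; have [lo_w le_x] := chain_mem ch wx_out.
have lt_i : index (w, x) out < m 0 by rewrite m00 index_mem.
have lt_w : w.-1 < n by lia.
have lt_x : x.-1 < n by lia.
exists (Ordinal lt_i); apply/existsP; exists (Ordinal lt_w).
apply/existsP; exists (Ordinal lt_x) => /=.
have [] := items (index (w, x) out); first by rewrite -m00.
rewrite nth_index //= => -> ->; rewrite -edge_ofE /=.
by rewrite !prednK ?eqxx //; lia.
Qed.

Lemma output_spec_maximum m : output_spec n (position pi) m ->
  maximum_induced_matching pi (decode_output n m).
Proof.
move=> [out [m00 ch [_ max] items]]; rewrite (decode_outputE m00 ch items).
have [ind card _] := chain_edges (leqnn n) ch; split=> // M indM.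
have [|l ch_l <-] := @matching_chain _ pi M n n indM; first by move=> e u; split.
by rewrite card; apply: max.
Qed.

Lemma init_mem_ord (i : 'I_n) : init_mem pi i.+1 = (pi i).+1.
Proof. by rewrite /init_mem /= valK. Qed.

Lemma init_mem_gt a : n < a -> init_mem pi a = 0.
Proof.
case: a => // a lt_a; rewrite /init_mem /= insubF //; lia.
Qed.

Lemma init_memK i : 0 < i <= n ->
  0 < init_mem pi i <= n /\ position pi (init_mem pi i) = i.
Proof.
case: i => // i lt_i; rewrite (init_mem_ord (Ordinal lt_i)) position_ord permK.
by rewrite /= ltn_ord.
Qed.

Lemma positionK x : 0 < x <= n ->
  0 < position pi x <= n /\ init_mem pi (position pi x) = x.
Proof.
case: x => // x lt_x; rewrite (position_ord pi (Ordinal lt_x)) init_mem_ord permKV.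
by rewrite /= ltn_ord.
Qed.

Lemma main_cmd_perm :
  terminates main_cmd ([seq init_mem pi r | r <- iota 0 nreg], init_mem pi)
    (1000 * n ^ 2 + 1000)
    (fun st => forall m, represents m st -> output_spec n (position pi) m).
Proof.
have [n0|n_gt0] := posnP n.
  (* For [n = 0] the initial memory already encodes the empty output; the additive constant pays for
     the test. *)
  apply: (@terminates_leq _ _ 2); last by lia.
  apply: terminates_ite => // nz; first by rewrite /= /init_mem /= n0 in nz.
  by run_block => m [rs _]; apply: output_spec0; rewrite ?rs.
apply: (@terminates_leq _ _ (1000 * n ^ 2)); last exact: leq_addr.
apply: (@main_cmd_ok n _ n_gt0 erefl (init_mem pi)) => //.
- exact: init_memK.
- exact: positionK.
- exact: init_mem_gt.
Qed.

End Permutation.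

(* There is a RAM program which, on input a permutation pi of {1..n},
   halts within O(n^2) steps and outputs a maximum induced matching of
   the permutation graph G(pi). *)
Theorem theorem1 :
  exists (p : seq instr) (c : nat),
    forall (n : nat) (pi : {perm 'I_n}),
      exists m : memory,
        run p (c * n ^ 2 + c) (0, init_mem pi) = Some m /\
        output_wf n m /\
        maximum_induced_matching pi (decode_output n m).
Proof.
exists (compile 0 main_cmd), 1000 => n pi.
have [t [m [st [le_t ns rep spec]]]] :=
  main_cmd_perm [::] [::] (represents_start (init_mem pi)).
have {}spec := spec m rep.
exists m; rewrite cats0 /= in ns; split; last first.
  by split; [apply: output_spec_wf spec | apply: output_spec_maximum].
(* The final program counter is the length of the program, where the machine stops. *)
exact: (nsteps_run ns).
Qed.
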